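(* Let $\Gamma$ be a metric graph, let $r\ge 0$ be an integer, let $D$ be a divisor on $\Gamma$ and let $\mathfrak S$ be a slope structure of width $r$ on $\Gamma$. Let $M\subseteq \mathrm{Rat}(D,\mathfrak S)$ be an admissible semimodule of rank $r$ with underlying slope structure $\mathfrak S$. Let $v$ be a point of $\Gamma$ and let $\underline a$ be a jump of the rank function $\rho_v$. Then there exists $f\in M$ such that $\partial_v(f)=s_{\underline a}$.
   Context: Metric graphs. A metric graph $\Gamma$ is the metric realization of a pair $(G,\ell)$, where $G=(V,E)$ is a finite connected graph with at least one edge and $\ell\colon E\to\mathbb R_{>0}$: each edge $e$ is replaced by a closed interval of length $\ell(e)$, glued according to $G$, with the path metric. $G$ (with $\ell$) is called a model of $\Gamma$; a model is simple if it has no loops and no parallel edges. $\mathrm T_x(\Gamma)$ is the finite set of outgoing unit tangent vectors at $x$, and $d_x=|\mathrm T_x(\Gamma)|$. $\mathrm{Rat}(\Gamma)$ is the set of continuous piecewise affine functions $f\colon\Gamma\to\mathbb R$ with integral slopes; $\mathrm{slope}_\nu(f)$ is the outgoing slope of $f$ along $\nu$. A divisor $D$ is a finite formal integer combination of points of $\Gamma$, $D(x)$ is its coefficient at $x$, $D\ge 0$ (effective) means all coefficients are $\geq 0$. $\mathrm{div}(f)=\sum_x \mathrm{ord}_x(f)(x)$ with $\mathrm{ord}_x(f)=-\sum_{\nu\in \mathrm T_x(\Gamma)}\mathrm{slope}_\nu(f)$. $\mathrm{Rat}(D)=\{f\in\mathrm{Rat}(\Gamma): D+\mathrm{div}(f)\ge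 0\}$. Hypercube rank functions. Put $[r]=\{0,\dots,r\}$. The hypercube $[r]^\delta$ ($\delta\geq 1$) carries the coordinatewise order $\preceq$ and coordinatewise max $\vee$ and min $\wedge$; $\underline e_i$ is the $i$-th unit vector. A rank function is a map $\rho\colon[r]^\delta\to\mathbb Z$ such that: (1) $\rho(t\,\underline e_i)=r-t$ for all $i$ and $t\in[r]$; (2) $\underline a\preceq\underline b$ implies $\rho(\underline b)\le\rho(\underline a)$; (3) $\rho(\underline a)+\rho(\underline b)\le\rho(\underline a\vee\underline b)+\rho(\underline a\wedge\underline b)$; (4) $\rho$ takes values in $\{-1,0,\dots,r\}$. A jump of $\rho$ is a point $\underline a$ with $\rho(\underline a)\ge 0$ and $\rho(\underline a+\underline e_i)=\rho(\underline a)-1$ for every $i$ with $\underline a+\underline e_i\in[r]^\delta$. The standard rank function is $\rho(\underline a)=\max\{-1,r-a_1-\dots-a_\delta\}$. Slope structures. A slope structure $\mathfrak S$ of width $r$ on $\Gamma$ is the data, on some simple graph model $G=(V,E)$ of $\Gamma$, of: for every oriented edge $uv$, a set $S^{uv}$ of integers $s_0^{uv}<\dots<s_r^{uv}$ with $s_i^{uv}+s_{r-i}^{vu}=0$; for every $v\in V$, a rank function $\rho_v$ on $[r]^{d_v}$, whose coordinates are indexed by the oriented edges with tail $v$ (equivalently by $\mathrm T_v(\Gamma)$). It is extended to all of $\Gamma$: for $\nu\in \mathrm T_x(\Gamma)$, $S^\nu=\{s_0^\nu<\dots<s_r^\nu\}$ is $S^{uv}$ for the oriented edge $uv$ parallel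 to $\nu$; for $x\in\Gamma\setminus V$, $\rho_x$ is the standard rank function on $[r]^2$. For $\underline a=(a_\nu)_\nu\in[r]^{\mathrm T_x(\Gamma)}$ put $s_{\underline a}=(s^\nu_{a_\nu})_\nu$, and let $S^x=\{s_{\underline a}:\underline a\text{ a jump of }\rho_x\}$. A function $f\in\mathrm{Rat}(\Gamma)$ is compatible with $\mathfrak S$ if for every $x\in\Gamma$, $\mathrm{slope}_\nu(f)\in S^\nu$ for all $\nu\in\mathrm T_x(\Gamma)$, and $\partial_x(f):=(\mathrm{slope}_\nu(f))_{\nu\in \mathrm T_x(\Gamma)}\in S^x$. If $\partial_x(f)=s_{\underline a}$, write $\rho_x(\partial_x(f)):=\rho_x(\underline a)$. $\mathrm{Rat}(D,\mathfrak S)$ is the set of $f\in\mathrm{Rat}(D)$ compatible with $\mathfrak S$. Admissible semimodules. A semimodule is a subset of $\mathrm{Rat}(\Gamma)$ stable under $(f,g)\mapsto\min(f,g)$ and $f\mapsto f+c$, $c\in\mathbb R$. A semimodule $M\subseteq\mathrm{Rat}(D)$ is admissible of rank $r$, with underlying slope structure $\mathfrak S$, if it is closed for the topology of $\|\cdot\|_\infty$, $\mathfrak S$ is a slope structure of width $r$ with $M\subseteq\mathrm{Rat}(D,\mathfrak S)$, and for every effective divisor $E$ of degree $r$ there is $f\in M$ with $\rho_x(\partial_x(f))\ge E(x)$ for all $x\in\Gamma$ and $D+\mathrm{div}(f)-E\ge 0$. *)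

(* Defs.v *)
From HB Require Import structures.
From mathcomp Require Import all_boot all_order all_algebra.
From mathcomp Require Import all_classical all_reals all_analysis.
Import Order.TTheory GRing.Theory Num.Theory.
Import numFieldNormedType.Exports.

Set Implicit Arguments.
Unset Strict Implicit.
Unset Printing Implicit Defensive.

Local Open Scope classical_set_scope.
Local Open Scope ring_scope.

(** * Weighted graphs and their metric realizations *)

(* [src] and [tgt] fix an arbitrary reference orientation of each edge.
   Loops and parallel edges are allowed. *)
Record wgraph (R : realType) := WGraph {
  vert : finType;
  edge : finType;
  src : edge -> vert;
  tgt : edge -> vert;
  len : edge -> R;
  len_gt0 : forall e, 0 < len e;
  edge_gt0 : (0 < #|edge|)%N;
  graph_connected : forall u w : vert,
    connect (fun x y => [exists e, ((src e == x) && (tgt e == y)) ||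
                                   ((src e == y) && (tgt e == x))]) u w
}.

Definition simple_graph (R : realType) (G : wgraph R) : Prop :=
  (forall e : edge G, src e != tgt e) /\
  (forall e e' : edge G, e != e' ->
     ~~ ((src e == src e') && (tgt e == tgt e')) /\
     ~~ ((src e == tgt e') && (tgt e == src e'))).

(* The metric realization: the vertices and the interior points of the edges.
   The gluing of the end points is carried out by [chart]. *)
Definition point (R : realType) (G : wgraph R) : Type :=
  (vert G + {e : edge G & {t : R | 0 < t < len e}})%type.

Definition chart (R : realType) (G : wgraph R) (e : edge G) (t : R) : point G :=
  if t <= 0 then inl (src e)
  else if insub t is Some u
       then inr (existT (fun e' : edge G => {s : R | 0 < s < len e'}) e u)
       else inl (tgt e).

(* [walk x y L]: y is reached from x by finitely many moves, each inside one
   closed edge, of total length L. *)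
Inductive walk (R : realType) (G : wgraph R) : point G -> point G -> R -> Prop :=
| walk_nil x : walk x x 0
| walk_move (e : edge G) (s t : R) (y : point G) (L : R) :
    0 <= s <= len e -> 0 <= t <= len e ->
    walk (chart e t) y L -> walk (chart e s) y (`|s - t| + L).

Definition path_dist (R : realType) (G : wgraph R) (x y : point G) : R :=
  inf [set L | walk x y L].

Record model (R : realType) (X : metricType R) := Model {
  graph :> wgraph R;
  real : point graph -> X;
  real_bij : bijective real;
  real_isometry : forall x y, mdist (real x) (real y) = path_dist x y
}.

Record metric_graph (R : realType) := MetricGraph {
  space :> metricType R;
  has_model : inhabited (model space)
}.

(** * Tangent vectors, rational functions and divisors *)

(* An oriented edge is an edge with a flag telling whether the reference
   orientation is reversed. *)
Definition oedge (R : realType) (G : wgraph R) : finType := (edge G * bool)%type.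

Definition orev (R : realType) (G : wgraph R) (o : oedge G) : oedge G :=
  (o.1, ~~ o.2).

Definition along (R : realType) (X : metricType R) (m : model X)
    (o : oedge m) (t : R) : X :=
  real (chart o.1 (if o.2 then len o.1 - t else t)).

(* T_x: a unit tangent vector at x is encoded by the oriented edge along which
   it points.  At a vertex these are the oriented edges with that tail (both
   orientations of a loop); in the interior of an edge, its two orientations.

   The notions below are computed in a model, but T_x, Rat, slope and div do not
   depend on it: two models of X differ by subdivisions preserving arc length. *)
Definition tangent_set (R : realType) (X : metricType R) (m : model X) (x : X) :
    {set oedge m} :=
  [set o : oedge m | `[< exists2 t : R, 0 <= t < len o.1 & along o t = x >]]%SET.

Definition tangent (R : realType) (X : metricType R) (m : model X) (x : X) :
  finType := {o : oedge m | o \in tangent_set m x}.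

Definition rat_fun (R : realType) (X : metricType R) (m : model X)
    (f : X -> R) : Prop :=
  continuous f /\
  forall e : edge m, exists breaks : seq R,
  forall a b : R, 0 <= a -> a <= b -> b <= len e ->
    (forall t, t \in breaks -> ~~ (a < t < b)) ->
    exists k : int, forall t, a <= t <= b ->
      f (real (chart e t)) = f (real (chart e a)) + k%:~R * (t - a).

Definition is_slope (R : realType) (X : metricType R) (m : model X)
    (f : X -> R) (x : X) (o : oedge m) (k : int) : Prop :=
  exists2 t : R, 0 <= t < len o.1 /\ along o t = x &
    \forall h \near 0^'+, f (along o (t + h)) = f x + k%:~R * h.

(* The value 0 is a dummy, used only when f has no integral slope along o. *)
Definition slope (R : realType) (X : metricType R) (m : model X)
    (f : X -> R) (x : X) (o : oedge m) : int :=
  xget 0 [set k | is_slope f x o k].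

Definition ord (R : realType) (X : metricType R) (m : model X)
    (f : X -> R) (x : X) : int :=
  - \sum_(o in tangent_set m x) slope f x o.

Record divisor (X : Type) := Divisor {
  coef :> X -> int;
  coef_finite : finite_set [set x | coef x != 0]
}.

Definition effective (X : Type) (D : divisor X) : Prop := forall x, 0 <= D x.

Definition degree (X : choiceType) (D : divisor X) : int :=
  \sum_(x \in [set: X]) D x.

Definition in_RatD (R : realType) (X : metricType R) (m : model X)
    (D : divisor X) (f : X -> R) : Prop :=
  rat_fun m f /\ forall x, 0 <= D x + ord m f x.

(** * Rank functions on hypercubes *)

(* [r]^I with [r] = {0, ..., r}, for a finite set I of coordinates. *)
Definition cube (r : nat) (I : finType) : Type := {ffun I -> 'I_r.+1}.

Definition cube_axis (r : nat) (I : finType) (i : I) (t : 'I_r.+1) : cube r I :=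
  [ffun j => if j == i then t else ord0].

Definition cube_le (r : nat) (I : finType) (a b : cube r I) : Prop :=
  forall i, (a i <= b i)%N.

Definition cube_join (r : nat) (I : finType) (a b : cube r I) : cube r I :=
  [ffun i => if (a i <= b i)%N then b i else a i].

Definition cube_meet (r : nat) (I : finType) (a b : cube r I) : cube r I :=
  [ffun i => if (a i <= b i)%N then a i else b i].

Definition rank_function (r : nat) (I : finType) (rho : cube r I -> int) : Prop :=
  [/\ forall (i : I) (t : 'I_r.+1), rho (cube_axis i t) = r%:Z - (t : nat)%:Z,
      forall a b, cube_le a b -> rho b <= rho a,
      forall a b, rho a + rho b <= rho (cube_join a b) + rho (cube_meet a b)
    & forall a, -1 <= rho a <= r%:Z].

(* The hypothesis on b says b = a + e_i; quantifying over b in the cube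
   restricts to those i for which a + e_i lies in the cube. *)
Definition is_jump (r : nat) (I : finType) (rho : cube r I -> int)
    (a : cube r I) : Prop :=
  0 <= rho a /\
  forall (i : I) (b : cube r I),
    (forall j, (b j : nat) = (a j + (j == i))%N) -> rho b = rho a - 1.

Definition standard_rank (r : nat) (I : finType) (a : cube r I) : int :=
  Num.max (-1) (r%:Z - (\sum_i (a i : nat))%N%:Z).

(** * Slope structures *)

(* [oslope o] lists S^o in increasing order.  The rank functions are recorded
   at all points, those outside the vertex set being forced to be standard. *)
Record slope_structure (R : realType) (X : metricType R) (r : nat) :=
  SlopeStructure {
  smodel :> model X;
  smodel_simple : simple_graph smodel;
  oslope : oedge smodel -> 'I_r.+1 -> int;
  oslope_incr : forall (o : oedge smodel) (i j : 'I_r.+1),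
    (i < j)%N -> oslope o i < oslope o j;
  oslope_rev : forall (o : oedge smodel) (i : 'I_r.+1),
    oslope o i + oslope (orev o) (rev_ord i) = 0;
  rho : forall x : X, cube r (tangent smodel x) -> int;
  rho_vertex : forall v : vert smodel, rank_function (@rho (real (inl v)));
  rho_inner : forall x : X, (forall v : vert smodel, x <> real (inl v)) ->
    @rho x = @standard_rank r (tangent smodel x)
}.

Arguments rho {R X r} s x a.

Definition slope_vector (R : realType) (X : metricType R) (r : nat)
    (S : slope_structure X r) (x : X) (a : cube r (tangent S x)) :
    {ffun tangent S x -> int} :=
  [ffun o : tangent S x => oslope (val o) (a o)].

Definition partial (R : realType) (X : metricType R) (m : model X)
    (f : X -> R) (x : X) : {ffun tangent m x -> int} :=
  [ffun o : tangent m x => slope f x (val o)].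

Definition compatible (R : realType) (X : metricType R) (r : nat)
    (S : slope_structure X r) (f : X -> R) : Prop :=
  rat_fun S f /\
  forall x : X,
    (forall o : tangent S x, exists i : 'I_r.+1, slope f x (val o) = oslope (val o) i) /\
    (exists2 a : cube r (tangent S x),
       is_jump (rho S x) a & partial S f x = slope_vector a).

Definition in_RatDS (R : realType) (X : metricType R) (r : nat)
    (D : divisor X) (S : slope_structure X r) (f : X -> R) : Prop :=
  in_RatD S D f /\ compatible S f.

(** * Admissible semimodules *)

Definition semimodule (R : realType) (X : metricType R) (m : model X)
    (M : set (X -> R)) : Prop :=
  [/\ forall f, M f -> rat_fun m f,
      forall f g, M f -> M g -> M (fun x => Num.min (f x) (g x))
    & forall f (c : R), M f -> M (fun x => f x + c)].

(* The topology of {uniform X -> R} is that of the sup norm.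
   Since the oslope o i are distinct in i, the multi-index a with
   partial S f x = slope_vector a is unique, and rho S x a is rho_x(partial_x f). *)
Definition admissible (R : realType) (X : metricType R) (r : nat)
    (D : divisor X) (S : slope_structure X r) (M : set (X -> R)) : Prop :=
  [/\ semimodule S M,
      closed (M : set {uniform X -> R}),
      forall f, M f -> in_RatDS D S f
    & forall E : divisor X, effective E -> degree E = r%:Z ->
      exists2 f, M f &
        (forall x : X, exists2 a : cube r (tangent S x),
           partial S f x = slope_vector a & E x <= rho S x a) /\
        (forall x : X, 0 <= D x + ord S f x - E x)].

(* Main.v *)
(* On an edge, a function compatible with the slope structure is concave.  If
   c' and c' + e_i have the same rank, any jump above c' lies above c' + e_i.
   Otherwise, require one more drop of slope at a point of the edge i very close
   to v: if functions of M with slope index only c'_i at v satisfied this for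
   drops arbitrarily close to v, a limit of them would lie in M (M is closed)
   and have slope index below c'_i at v.  By induction, r - rho_v(a) suitable
   drops force the slope indices at v to be at least a.  Placing rho_v(a) points
   at v and one point at each drop gives an effective divisor of degree r, and
   the function attached to it by admissibility has at v a jump above a of rank
   at least rho_v(a): it is a. *)

Require Import Defs.
From HB Require Import structures.
From mathcomp Require Import all_boot all_order all_algebra.
From mathcomp Require Import all_classical all_reals all_analysis.
From mathcomp Require Import zify ring lra.
Import Order.TTheory GRing.Theory Num.Theory.
Import numFieldNormedType.Exports.

Set Implicit Arguments.
Unset Strict Implicit.
Unset Printing Implicit Defensive.

Local Open Scope classical_set_scope.
Local Open Scope ring_scope.

(** * Rank functions on hypercubes and their jumps *)

Section RankFunctions.
Context (r : nat) (I : finType).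
Implicit Types (a b c : cube r I) (i : I).

(** The coordinate sum is modular and truncation at -1 is convex in it, whence supermodularity. *)
Lemma standard_rank_rank_function : rank_function (@standard_rank r I).
Proof.
split=> [i t|a b ab|a b|a].
- rewrite /standard_rank /cube_axis (bigD1 i)//= ffunE eqxx big1 ?addn0.
    by have := ltn_ord t; lia.
  by move=> j ji; rewrite ffunE (negbTE ji).
- rewrite /standard_rank.
  have : (\sum_i a i <= \sum_i b i)%N by apply: leq_sum => i _; exact: ab.
  lia.
- rewrite /standard_rank.
  have : (\sum_i a i + \sum_i b i =
      \sum_i cube_join a b i + \sum_i cube_meet a b i)%N.
    rewrite -!big_split; apply: eq_bigr => i _ /=; rewrite !ffunE.
    by case: ifP => _ //; rewrite addnC.
  have : (\sum_i a i <= \sum_i cube_join a b i)%N.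
    by apply: leq_sum => i _; rewrite ffunE; case: ifP.
  have : (\sum_i b i <= \sum_i cube_join a b i)%N.
    by apply: leq_sum => i _; rewrite ffunE; case: ifP; lia.
  lia.
- by rewrite /standard_rank; lia.
Qed.

Lemma cube_leP a b :
  cube_le a b \/ exists i, (b i < a i)%N.
Proof.
have [ab|/existsNP[i /negP]] := pselect (cube_le a b); first by left.
by rewrite -ltnNge; right; exists i.
Qed.

Lemma cube_le_anti a b : cube_le a b -> cube_le b a -> a = b.
Proof.
move=> ab ba; apply/ffunP => i; apply/val_inj/eqP.
by rewrite eqn_leq ab ba.
Qed.

Lemma cube_succ_exists a i : (a i < r)%N ->
  exists b : cube r I, forall j, (b j : nat) = (a j + (j == i))%N.
Proof.
move=> air; exists [ffun j => if j == i then inord (a i).+1 else a j] => j.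
rewrite ffunE; case: eqP => [->|_]; last by rewrite addn0.
by rewrite inordK ?addn1.
Qed.

Lemma cube_pred_exists a i : (0 < a i)%N ->
  exists b : cube r I, forall j, (a j : nat) = (b j + (j == i))%N.
Proof.
move=> ai0; exists [ffun j => if j == i then inord (a i).-1 else a j] => j.
rewrite ffunE; case: eqP => [->|_]; last by rewrite addn0.
by rewrite /= addn1 inordK prednK//; apply: ltnW; exact: ltn_ord.
Qed.

Context (rho : cube r I -> int) (rhoP : rank_function rho).

(** The origin lies on the axis of [i]; over an empty [I] the axioms do not fix its rank. *)
Lemma rank_cube0 i : rho [ffun=> ord0] = r%:Z.
Proof.
case: rhoP => + _ _ _ => /(_ i ord0) /=; rewrite subr0 => <-.
by congr rho; apply/ffunP => j; rewrite !ffunE; case: ifP.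
Qed.

(** Supermodularity at [c'] and the point of height [c i] on the axis of [i]: the join is [c], and
    the meet lies one step lower on that axis. *)
Lemma rank_succ_ge c' c i :
  (forall j, (c j : nat) = (c' j + (j == i))%N) -> rho c' <= rho c + 1.
Proof.
move=> cE; case: rhoP => rho_axis _ rho_super _.
have ord0E : (ord0 : 'I_r.+1) = 0%N :> nat by [].
have := rho_super c' (cube_axis i (c i)).
have -> : cube_join c' (cube_axis i (c i)) = c.
  apply/ffunP => j; apply/val_inj => /=; rewrite !ffunE.
  have := cE j; case: eqP => [->|_] /=; case: ifP; lia.
have -> : cube_meet c' (cube_axis i (c i)) = cube_axis i (c' i).
  apply/ffunP => j; apply/val_inj => /=; rewrite !ffunE.
  have := cE j; case: eqP => [->|_] /=; case: ifP; lia.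
by rewrite !rho_axis; have := cE i; rewrite eqxx; lia.
Qed.

(** If [b i = c' i], then [b + e_i] and [c'] are the join and the meet of [b] and [c];
    supermodularity then forbids the rank to drop from [b] to [b + e_i], contrary to the jump. *)
Lemma jump_gt_of_rank_eq c' c b i : is_jump rho b ->
  (forall j, (c j : nat) = (c' j + (j == i))%N) -> rho c = rho c' ->
  cube_le c' b -> cube_le c b.
Proof.
move=> [_ b_jump] cE rhoE c'b.
suff bi : (c' i < b i)%N.
  by move=> j; rewrite cE; have := c'b j; case: eqP => [->|_]; lia.
rewrite ltnNge; apply/negP => bi.
have [|b' b'E] := @cube_succ_exists b i.
  by have := cE i; rewrite eqxx; have := ltn_ord (c i); lia.
have := b_jump i b' b'E; case: rhoP => _ _ /(_ b c) + _.
have -> : cube_join b c = b'.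
  apply/ffunP => j; apply/val_inj => /=; rewrite !ffunE.
  have := cE j; have := b'E j; have := c'b j.
  by case: eqP => [->|_] /=; case: ifP; lia.
have -> : cube_meet b c = c'.
  apply/ffunP => j; apply/val_inj => /=; rewrite !ffunE.
  have := cE j; have := c'b j.
  by case: eqP => [->|_] /=; case: ifP; lia.
by rewrite rhoE; lia.
Qed.

(** Otherwise some [a + e_i] lies below [b], and its rank [rho a - 1] bounds that of [b]. *)
Lemma jump_maximal a b :
  is_jump rho a -> cube_le a b -> rho a <= rho b -> a = b.
Proof.
move=> [_ a_jump] ab rho_ab; apply: cube_le_anti => //.
case: (cube_leP b a) => // -[i ai].
have [|e eE] := @cube_succ_exists a i; first by have := ltn_ord (b i); lia.
have eb : cube_le e b.
  by move=> j; rewrite eE; have := ab j; case: eqP => [->|_]; lia.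
by case: rhoP => _ /(_ _ _ eb) + _ _; have := a_jump i e eE; lia.
Qed.

End RankFunctions.

(** * Real induction and concavity of piecewise affine functions *)

Section RealLine.
Context (R : realType).

Lemma near_right0P (P : R -> Prop) :
  (\forall h \near 0^'+, P h) <-> exists2 d, 0 < d & forall h, 0 < h < d -> P h.
Proof.
split=> [[d /= d0 dP]|[d d0 dP]].
  exists d => // h /andP[h0 hd]; apply: dP => //=.
  by rewrite sub0r normrN gtr0_norm.
exists d => //= h /=; rewrite sub0r normrN => hd h0.
by apply: dP; rewrite h0 -(gtr0_norm h0).
Qed.

(** [A] collects the points up to which [Q] holds throughout; [Qleft] carries [Q] to [sup A], and
    [Qright] excludes [sup A < b]. *)
Lemma real_induction (Q : R -> Prop) (a b : R) :
  Q a ->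
  (forall s, a <= s < b -> (forall u, a <= u <= s -> Q u) ->
    exists2 d, 0 < d & forall u, s < u < s + d -> Q u) ->
  (forall s, a < s <= b -> (forall u, a <= u < s -> Q u) -> Q s) ->
  forall s, a <= s <= b -> Q s.
Proof.
move=> Qa Qright Qleft s /andP[as_ sb].
have ab : a <= b := le_trans as_ sb.
pose A := [set s | a <= s <= b /\ forall u, a <= u <= s -> Q u].
have Aa : A a.
  by split=> [|u]; [rewrite lexx|rewrite -eq_le => /eqP <-].
have Ab : ubound A b by move=> u [/andP[]].
have supA : has_sup A by split; [exists a|exists b].
have az : a <= sup A by apply: ub_le_sup => //; exact: supA.2.
have zb : sup A <= b by apply: ge_sup => //; exact: supA.1.
have Qlt u : a <= u < sup A -> Q u.
  move=> /andP[au uz]; have [t [_ tQ] ut] := sup_gt supA.1 uz.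
  by apply: tQ; rewrite au ltW.
have Qle u : a <= u <= sup A -> Q u.
  move=> /andP[au]; rewrite le_eqVlt => /predU1P[uz|uz]; last first.
    by apply: Qlt; rewrite au.
  have [<-//|az'] := eqVneq a u.
  apply: Qleft; last by rewrite uz.
  by rewrite lt_neqAle az' au /= uz.
have [zb'|bz] := ltP (sup A) b; last first.
  by apply: Qle; rewrite as_ (le_trans sb).
have [|d d0 dQ] := Qright (sup A) _ Qle; first by rewrite az zb'.
pose t := Num.min b (sup A + d / 2).
have zt : sup A < t by rewrite lt_min zb' /=; lra.
suff /(ub_le_sup supA.2) : A t by rewrite leNgt zt.
split=> [|u /andP[au ut]].
  by rewrite ge_min lexx (le_trans az (ltW zt)).
have [uz|zu] := leP u (sup A); first by apply: Qle; rewrite au.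
apply: dQ; rewrite zu /= (le_lt_trans ut)// gt_min; apply/orP; right; lra.
Qed.

(* The slope property is propagated along with the bound on values: it is what
   survives the passage through a break point. *)
Lemma concave_le_tangent (g kr kl : R -> R) (L : R) :
  (forall t, 0 <= t < L -> \forall h \near 0^'+, g (t + h) = g t + kr t * h) ->
  (forall t, 0 < t <= L -> \forall h \near 0^'+, g (t - h) = g t + kl t * h) ->
  (forall t, 0 < t < L -> kr t + kl t <= 0) ->
  forall t h, 0 <= t -> 0 <= h -> t + h <= L -> g (t + h) <= g t + kr t * h.
Proof.
move=> g_right g_left k_le t h t0 h0 thL.
(* The slope clause stops before [L], where [kr] is unconstrained. *)
pose Q u := g u <= g t + kr t * (u - t) /\ (u < L -> kr u <= kr t).
suff : Q (t + h) by case; rewrite (addrC t) addrK.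
(* Two affine germs at one point agree at a common small step, so their slopes agree. *)
have aff_slope u (k d : R) : 0 <= u < L -> 0 < d ->
    (forall h, 0 < h < d -> g (u + h) = g u + k * h) -> kr u = k.
  move=> uL d0 uk; have /near_right0P[d' d'0 uk'] := g_right u uL.
  pose e := Num.min d d' / 2.
  have e0 : 0 < e by rewrite divr_gt0// lt_min d0.
  have [ed ed'] : e < d /\ e < d'.
    by split; rewrite /e; case: (leP d d'); lra.
  have := uk e; rewrite uk' ?e0//= => /(_ ed) /addrI.
  by apply: mulIf; rewrite gt_eqF.
apply: (@real_induction Q t (t + h)).
- by split; rewrite ?subrr ?mulr0 ?addr0.
- move=> s /andP[ts sth] Qs; have [gs ks] : Q s by apply: Qs; rewrite ts lexx.
  have sL : 0 <= s < L by lra.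
  have {}ks : kr s <= kr t by apply: ks; lra.
  have /near_right0P[d d0 sk] := g_right s sL.
  exists d => // u /andP[su usd]; split=> [|uL].
    have := sk (u - s); have -> : s + (u - s) = u by ring.
    move=> ->; last lra.
    have : kr s * (u - s) <= kr t * (u - s) by apply: ler_wpM2r => //; lra.
    lra.
  suff -> : kr u = kr s by [].
  apply: (aff_slope u (kr s) (s + d - u)); rewrite ?subr_gt0//; first by lra.
  move=> e e0; have := sk (u - s); have := sk (u + e - s).
  have -> : s + (u + e - s) = u + e by ring.
  have -> : s + (u - s) = u by ring.
  by move=> ->; [move=> ->; [ring|lra]|lra].
- move=> s /andP[ts sth] Qs.
  have sL : 0 < s <= L by lra.
  have /near_right0P[d d0 sk] := g_left s sL.
  pose e := Num.min d (s - t) / 2.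
  have e0 : 0 < e by rewrite divr_gt0// lt_min d0 subr_gt0.
  have [ed est] : e < d /\ e < s - t.
    by split; rewrite /e; case: (leP d (s - t)); lra.
  have [|gse kse] := Qs (s - e); first lra.
  (* Just left of [s] the function is affine, with forward slope [- kl s]. *)
  have kE : kr (s - e) = - kl s.
    apply: (aff_slope _ _ e) => //; first lra.
    move=> x xe; have := sk e; have := sk (e - x).
    have -> : s - (e - x) = s - e + x by ring.
    by move=> ->; [move=> ->; [ring|lra]|lra].
  have {}kse : - kl s <= kr t by rewrite -kE; apply: kse; lra.
  split=> [|sL']; last by have := k_le s; lra.
  move: gse; rewrite sk; last lra.
  have : - kl s * e <= kr t * e by apply: ler_wpM2r => //; lra.
  lra.
- by rewrite lerDl h0 lexx.
Qed.

End RealLine.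

(** * Edge charts of the metric realization *)

Section Charts.
Context (R : realType) (G : wgraph R).
Implicit Types (e : edge G) (t : R).

(** Reads the parameter off without inverting an equality of dependent pairs. *)
Definition position (p : Defs.point G) : R :=
  if p is inr u then val (projT2 u) else 0.

Lemma chart_src e : chart e 0 = inl (src e).
Proof. by rewrite /chart lexx. Qed.

Lemma chart_tgt e : chart e (len e) = inl (tgt e).
Proof.
rewrite /chart leNgt len_gt0 /=; case: insubP => [u + uE|//].
by rewrite ltxx andbF.
Qed.

Lemma chart_inner e t (tP : 0 < t < len e) :
  chart e t = inr (existT (fun e' => {s : R | 0 < s < len e'}) e (Sub t tP)).
Proof.
rewrite /chart leNgt; case/andP: (tP) => -> _ /=.
by case: insubP => [u _ uE|/negP//]; congr (inr (existT _ _ _)); exact: val_inj.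
Qed.

Lemma chart_inj e : src e != tgt e ->
  {in [pred t | 0 <= t <= len e] &, injective (chart e)}.
Proof.
move=> loopless; have chartP t : 0 <= t <= len e ->
    [\/ t = 0, t = len e | 0 < t < len e].
  by rewrite !le_eqVlt => /andP[/predU1P[<-|t0] /predU1P[->|t1]];
    [constructor 1|constructor 1|constructor 2|constructor 3; rewrite t0].
move=> s t; rewrite !inE => /chartP sP /chartP tP.
case: sP => [->|->|sP]; case: tP => [->|->|tP] //;
  rewrite ?chart_src ?chart_tgt ?chart_inner//.
- by move=> -[/eqP]; rewrite (negbTE loopless).
- by move=> -[/esym/eqP]; rewrite (negbTE loopless).
- by move=> /(congr1 position).
Qed.

End Charts.

Lemma point_chart (R : realType) (G : wgraph R) (p : Defs.point G) :
  (exists u, p = inl u) \/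
  exists e t, 0 <= t <= len e /\ p = chart e t.
Proof.
case: p => [u|[e [t tP]]]; first by left; exists u.
right; exists e, t; rewrite (chart_inner tP); split; last first.
  by congr (inr (existT _ _ _)); exact: val_inj.
by case/andP: tP => /ltW -> /ltW.
Qed.

Lemma breaks_gap_right (R : realType) (bs : seq R) (t : R) :
  exists2 d, 0 < d & forall u, u \in bs -> ~~ (t < u < t + d).
Proof.
elim: bs => [|b bs [d d0 dP]]; first by exists 1.
have [tb|bt] := ltP t b; last first.
  exists d => // u /predU1P[->|/dP//]; by rewrite ltNge bt.
exists (Num.min d (b - t)); first by rewrite lt_min d0 subr_gt0.
have [dle1 dle2] : Num.min d (b - t) <= d /\ Num.min d (b - t) <= b - t.
  by rewrite !ge_min !lexx orbT.
move=> u /predU1P[->|/dP]; lra.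
Qed.

Lemma breaks_gap_left (R : realType) (bs : seq R) (t : R) :
  exists2 d, 0 < d & forall u, u \in bs -> ~~ (t - d < u < t).
Proof.
have [d d0 dP] := breaks_gap_right [seq - b | b <- bs] (- t).
exists d => // u ub; have := dP (- u).
rewrite (mem_map (@oppr_inj R)) => /(_ ub); lra.
Qed.

(** * Slopes along oriented edges *)

Section Edges.
Context (R : realType) (X : metricType R) (m : model X).
Context (m_simple : simple_graph m).
Implicit Types (o : oedge m) (f : X -> R).

Lemma along_rev o t : along (orev o) t = along o (len o.1 - t).
Proof. by case: o => e [] /=; rewrite /along /= ?subKr. Qed.

Lemma real_inj : injective (@real R X m).
Proof. exact: bij_inj (real_bij m). Qed.

Lemma along_inj o :
  {in [pred t | 0 <= t <= len o.1] &, injective (along o)}.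
Proof.
move=> s t; rewrite !inE => sL tL /real_inj.
have /chart_inj cI := m_simple.1 o.1.
by case: o.2 => /cI; rewrite !inE => st; [have := st _ _|]; [lra|exact: st].
Qed.

Lemma along_inner o t (w : vert m) :
  0 < t < len o.1 -> along o t <> real (inl w).
Proof.
by rewrite /along => tP /real_inj; case: o.2; rewrite chart_inner//; lra.
Qed.

Lemma is_slope_exists f o t : rat_fun m f -> 0 <= t < len o.1 ->
  exists k, is_slope f (along o t) o k.
Proof.
move=> [_ f_aff] tL; have [bs bsP] := f_aff o.1.
suff [k [d d0 kP]] : exists k : int, exists2 d, 0 < d &
    forall h, 0 < h < d -> f (along o (t + h)) = f (along o t) + k%:~R * h.
  by exists k, t => //; apply/near_right0P; exists d.
rewrite /along; case: o.2.
- have [d d0 dP] := breaks_gap_left bs (len o.1 - t).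
  pose d' := Num.min d (len o.1 - t).
  have d'0 : 0 < d' by rewrite lt_min d0 /=; lra.
  have [d'd d'L] : d' <= d /\ d' <= len o.1 - t by rewrite !ge_min !lexx orbT.
  have [||||k kP] := bsP (len o.1 - t - d') (len o.1 - t); try lra.
    by move=> u /dP; lra.
  (* Moving along the reversed edge lowers the chart parameter, hence the sign and the gap on the
     left. *)
  exists (- k), d' => // h hd'.
  rewrite (kP (len o.1 - t)); last lra.
  rewrite (kP (len o.1 - (t + h))); last lra.
  by rewrite mulrNz; ring.
- have [d d0 dP] := breaks_gap_right bs t.
  pose d' := Num.min d (len o.1 - t).
  have d'0 : 0 < d' by rewrite lt_min d0 /=; lra.
  have [d'd d'L] : d' <= d /\ d' <= len o.1 - t by rewrite !ge_min !lexx orbT.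
  have [||||k kP] := bsP t (t + d'); try lra.
    by move=> u /dP; lra.
  exists k, d' => // h hd'.
  rewrite (kP (t + h)); last lra.
  by congr (_ + _ * _); ring.
Qed.

(** A slope exists, so [slope] is a genuine one; injectivity of [along] identifies the parameter
    hidden in [is_slope] with [t]. *)
Lemma slope_near f o t : rat_fun m f -> 0 <= t < len o.1 ->
  \forall h \near 0^'+,
    f (along o (t + h)) = f (along o t) + (slope f (along o t) o)%:~R * h.
Proof.
move=> fR tL; have /(@xgetPex _ 0) := is_slope_exists fR tL.
rewrite -/(slope f (along o t) o) => -[t' [t'L /along_inj tE]].
by rewrite tE ?inE//; lra.
Qed.

Lemma mem_tangent_set o t : 0 <= t < len o.1 -> o \in tangent_set m (along o t).
Proof. by move=> tL; rewrite inE; apply/asboolP; exists t. Qed.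

End Edges.

(** * Concavity, drops and Lipschitz bounds for compatible functions *)

Section Compatible.
Context (R : realType) (X : metricType R) (r : nat) (S : slope_structure X r).
Implicit Types (o : oedge S) (f : X -> R) (x : X).

Let S_simple : simple_graph S := smodel_simple S.

Lemma rho_rank_function x : rank_function (rho S x).
Proof.
have [[w ->]|nw] := pselect (exists w : vert S, x = real (inl w)).
  exact: rho_vertex.
rewrite rho_inner; first exact: standard_rank_rank_function.
by move=> w xw; apply: nw; exists w.
Qed.

Lemma oslope_le_homo o (i j : 'I_r.+1) : (i <= j)%N -> oslope o i <= oslope o j.
Proof.
rewrite leq_eqVlt => /predU1P[/val_inj -> //|ij].
by apply/ltW/oslope_incr.
Qed.

Lemma slope_partial f x (a : cube r (tangent S x)) (o : tangent S x) :
  partial S f x = slope_vector a -> slope f x (val o) = oslope (val o) (a o).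
Proof. by move=> /ffunP/(_ o); rewrite !ffunE. Qed.

(* At a point inside an edge, the two outgoing slopes have indices i and j with
   i + j <= r - rho, so the slope decreases by at least rho. *)
Lemma slope_inner_le f o t (a : cube r (tangent S (along o t))) (q : int) :
  0 < t < len o.1 -> partial S f (along o t) = slope_vector a ->
  0 <= q <= 1 -> q <= rho S (along o t) a ->
  slope f (along o t) o + slope f (along o t) (orev o) <= - q.
Proof.
move=> tL fa q01 qa.
have o1P : o \in tangent_set S (along o t).
  by apply: mem_tangent_set; lra.
have o2P : orev o \in tangent_set S (along o t).
  by rewrite -(subKr (len o.1) t) -along_rev; apply: mem_tangent_set => /=; lra.
pose o1 : tangent S (along o t) := Sub o o1P.
pose o2 : tangent S (along o t) := Sub (orev o) o2P.
have o12 : o2 != o1.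
  by apply/eqP => /(congr1 (fun u => (val u).2)) /=; case: o.2.
rewrite (slope_partial o1 fa) (slope_partial o2 fa) !SubK.
have : (a o1 + a o2 <= \sum_i a i)%N.
  by rewrite (bigD1 o1)//= (bigD1 o2)//= addnA leq_addr.
move: qa; rewrite rho_inner /standard_rank; last first.
  by move=> w; exact: along_inner.
move: (a o1) (a o2) (\sum_i _)%N => i j n qn ijn.
(* The slope of index [i] along [o] is minus that of index [rev_ord i] along [orev o], so it
   suffices to compare [j] with [rev_ord i]. *)
have jrev : (j + `|q| <= rev_ord i)%N by rewrite /=; lia.
have := oslope_rev o i.
have [q0|q1] : q = 0 \/ q = 1 by lia.
  have := @oslope_le_homo (orev o) j (rev_ord i).
  by move: jrev; rewrite q0 addn0 => -> /(_ isT); lia.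
have := @oslope_incr _ _ _ S (orev o) j (rev_ord i).
by move: jrev; rewrite q1 addn1 => -> /(_ isT); lia.
Qed.

Lemma concave_along f o t h : compatible S f ->
  0 <= t -> 0 <= h -> t + h <= len o.1 ->
  f (along o (t + h)) <= f (along o t) + (slope f (along o t) o)%:~R * h.
Proof.
move=> [fR fS] t0 h0 thL.
apply: (concave_le_tangent (g := fun t => f (along o t))
  (kr := fun t => (slope f (along o t) o)%:~R)
  (kl := fun t => (slope f (along o t) (orev o))%:~R) (L := len o.1)) => //.
- by move=> s sL; exact: slope_near.
- move=> s sL.
  have sL' : 0 <= len o.1 - s < len (orev o).1 by rewrite /=; lra.
  have := slope_near S_simple fR sL'.
  rewrite along_rev subKr; apply: filterS => u; rewrite along_rev => <-.
  by congr (f (along o _)); ring.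
- move=> s sL; rewrite -intrD lerz0.
  (* A jump has nonnegative rank, so the case [q = 0] applies. *)
  have [_ [a [a0 _] fa]] := fS (along o s).
  by have := slope_inner_le sL fa _ a0; rewrite oppr0; apply.
Qed.

(* A form of "the slope of f drops by at least 1 at x" that is stable under
   pointwise limits. *)
Definition drops f x := forall o t h h', along o t = x ->
  0 <= h' -> h' <= t -> 0 <= h -> t + h <= len o.1 ->
  (f (along o (t + h)) - f x) * h' + (f (along o (t - h')) - f x) * h
    <= - (h * h').

(** Concavity bounds both increments by the outgoing slopes, whose sum is at most -1; the two bounds
    are weighted by [h'] and [h] and added. *)
Lemma drops_of_rank f x (a : cube r (tangent S x)) : compatible S f ->
  partial S f x = slope_vector a -> 1 <= rho S x a -> drops f x.
Proof.
move=> fS fa a1 o t h h' xE h'0 h't h0 thL; subst x.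
(* A zero step makes both sides vanish; positive steps force the point to be interior to the
   edge. *)
have [->|h_neq0] := eqVneq h 0.
  by rewrite addr0 subrr !(mul0r, mulr0) addr0 oppr0.
have [->|h'_neq0] := eqVneq h' 0.
  by rewrite subr0 subrr !(mul0r, mulr0) addr0 oppr0.
have hp : 0 < h by rewrite lt_def h_neq0.
have h'p : 0 < h' by rewrite lt_def h'_neq0.
have k_le := slope_inner_le (q := 1) _ fa isT a1.
have {k_le} : ((slope f (along o t) o)%:~R +
    (slope f (along o t) (orev o))%:~R : R) <= -1.
  by rewrite -intrD -[-1]/((-1)%:~R) ler_int; apply: k_le; lra.
have fr := concave_along fS (o := o) (t := t) (h := h).
have fl := concave_along fS (o := orev o) (t := len o.1 - t) (h := h').
rewrite !along_rev subKr in fl.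
have -> : t - h' = len o.1 - (len o.1 - t + h') by ring.
move: fr fl; set kr := _%:~R; set kl := _%:~R.
set u := f (along o (t + h)); set w := f (along o (len o.1 - _)).
set y := f _ => fr fl kle.
have {}fr : u - y <= kr * h by rewrite lerBlDl; apply: fr; lra.
have {}fl : w - y <= kl * h' by rewrite lerBlDl; apply: fl => /=; lra.
have frh : (u - y) * h' <= kr * h * h' by rewrite ler_pM2r.
have flh : (w - y) * h <= kl * h' * h by rewrite ler_pM2r.
have : (kr + kl) * (h * h') <= -1 * (h * h') by rewrite ler_pM2r ?mulr_gt0.
lra.
Qed.

(** The sum bounds every allowed slope at once, independently of the function; the added 1 allows
    division. *)
Definition lipschitz_constant : R :=
  1 + \sum_(o : oedge S) \sum_i `|(oslope o i)%:~R|.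

Lemma lipschitz_constant_gt0 : 0 < lipschitz_constant.
Proof. by rewrite ltr_pwDl// sumr_ge0// => o _; rewrite sumr_ge0. Qed.

Lemma slope_le f o t : compatible S f -> 0 <= t < len o.1 ->
  (slope f (along o t) o)%:~R <= lipschitz_constant.
Proof.
move=> [_ fS] tL; have oP := mem_tangent_set tL.
have [+ _] := fS (along o t) => /(_ (Sub o oP)) [i /= ->].
apply: (le_trans (ler_norm _)); rewrite /lipschitz_constant.
rewrite (bigD1 o)//= (bigD1 i)//= -[leLHS]add0r; apply: lerD => //.
rewrite -addrA lerDl addr_ge0 ?sumr_ge0// => o' _.
by rewrite sumr_ge0.
Qed.

(** Concavity bounds increments from above only; applying it in both directions of the edge gives
    both signs. *)
Lemma lipschitz_along f o s t : compatible S f ->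
  0 <= s <= len o.1 -> 0 <= t <= len o.1 ->
  `|f (along o s) - f (along o t)| <= lipschitz_constant * `|s - t|.
Proof.
move=> fS; wlog st : s t / s <= t => [H sL tL|sL tL].
  have [/H->//|/ltW/H] := leP s t.
  by rewrite distrC (distrC s); apply.
move: st; rewrite le_eqVlt => /predU1P[->|st].
  by rewrite !subrr !normr0 mulr0.
rewrite (distrC s) (gtr0_norm (x := t - s)) ?subr_gt0// ler_distl.
have K t' : 0 <= t' < len o.1 -> forall o', o'.1 = o.1 ->
    (slope f (along o' t') o')%:~R * (t - s) <= lipschitz_constant * (t - s).
  move=> t'L o' o'E; apply: ler_wpM2r; first by rewrite subr_ge0 ltW.
  by apply: slope_le => //; rewrite o'E.
apply/andP; split.
- have := concave_along fS (o := o) (t := s) (h := t - s).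
  have -> : s + (t - s) = t by ring.
  by have := K s _ o erefl; lra.
- have := concave_along fS (o := orev o) (t := len o.1 - t) (h := t - s).
  have := K (len o.1 - t) _ (orev o) erefl.
  rewrite !along_rev.
  have -> : len o.1 - (len o.1 - t + (t - s)) = s by ring.
  rewrite subKr /=; lra.
Qed.

Lemma lipschitz_mdist f x y : compatible S f ->
  `|f x - f y| <= lipschitz_constant * mdist x y.
Proof.
move=> fS; have [rinv _ rinvK] := real_bij S.
rewrite -(rinvK x) -(rinvK y) real_isometry.
move: (rinv x) (rinv y) => p q.
have walkP L : walk p q L ->
    `|f (real p) - f (real q)| <= lipschitz_constant * L.
  elim=> {p q L} [p|e s t q L sL tL _ IH]; first by rewrite subrr normr0 mulr0.
  rewrite mulrDr -(subrKA (f (real (chart e t)))) (le_trans (ler_normD _ _))//.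
  apply: lerD => //.
  exact: (lipschitz_along (o := (e, false))).
have [[L pqL]|no_walk] := pselect (exists L, walk p q L).
  rewrite -ler_pdivrMl ?lipschitz_constant_gt0//.
  apply: lb_le_inf; first by exists L.
  by move=> L' /walkP; rewrite ler_pdivrMl ?lipschitz_constant_gt0.
(* Without a walk, [path_dist] is the infimum of the empty set, which is 0 by convention. *)
suff -> : real p = real q.
  by rewrite subrr normr0 -real_isometry mulr_ge0 ?mdist_ge0 ?ltW
    ?lipschitz_constant_gt0.
apply: mdist_positivity; rewrite real_isometry /path_dist.
suff -> : [set L | walk p q L] = set0 by rewrite inf0.
by apply/seteqP; split=> // L pqL; apply: no_walk; exists L.
Qed.

End Compatible.

(** * Ultrafilter limits in an admissible semimodule *)

Lemma ultra_bounded_cvg (R : realType) (T : Type) (U : set_system T)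
    (U_ultra : UltraFilter U) (g : T -> R) (c : R) :
  (\forall i \near U, `|g i| <= c) -> exists l : R, g i @[i --> U] --> l.
Proof.
move=> gc; have gU : (g @ U) `[- c, c]%classic.
  by apply: filterS gc => i; rewrite /= in_itv /= ler_norml.
have [l [_ gl]] := segment_compact (fmap_proper_filter g _) gU.
(* An ultrafilter converges to each of its cluster points. *)
exists l => B /gl gB; case: (in_ultra_setVsetC (g @^-1` B) U_ultra) => // UnB.
by have [y []] := gB (~` B) UnB.
Qed.

Section Limits.
Context (R : realType) (X : metricType R) (r : nat) (S : slope_structure X r).
Context (D : divisor X) (M : set (X -> R)) (M_adm : admissible D S M).

Lemma admissible_compatible f : M f -> compatible S f.
Proof. by case: M_adm => _ _ MD _ /MD[]. Qed.

Lemma admissible_uniform_closed f :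
  (forall eps, 0 < eps -> exists2 g, M g & forall x, `|f x - g x| < eps) -> M f.
Proof.
case: M_adm => _ M_closed _ _ fM; apply: M_closed => B.
rewrite uniform_nbhs => -[E [+ EB]].
rewrite -entourage_ballE => -[eps /= eps0 epsE].
have [g Mg fg] := fM eps eps0.
by exists g; split=> //; apply: EB => y _; apply: epsE; exact: fg.
Qed.

(** Vanishing at [v] and the common Lipschitz constant bound the values at each point, so pointwise
    limits exist; on the finitely many compact edges the convergence is uniform, and [M] is
    closed. *)
Lemma admissible_limit (T : Type) (U : set_system T) (U_ultra : UltraFilter U)
    (F : T -> X -> R) (v : X) :
  (\forall i \near U, M (F i) /\ F i v = 0) ->
  exists2 f, M f & forall x, F i x @[i --> U] --> f x.
Proof.
move=> FM; pose C := lipschitz_constant S.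
have C0 : 0 < C := lipschitz_constant_gt0 S.
have FC : \forall i \near U, compatible S (F i).
  by apply: filterS FM => i [/admissible_compatible].
have /choice[f Ff] x : exists l : R, F i x @[i --> U] --> l.
  apply: (@ultra_bounded_cvg _ _ _ U_ultra _ (C * mdist x v)).
  apply: filterS FM => i [MFi Fiv].
  rewrite -[F i x]subr0 -Fiv; apply: lipschitz_mdist.
  exact: admissible_compatible.
have f_lip (o : oedge S) s t : 0 <= s <= len o.1 -> 0 <= t <= len o.1 ->
    `|f (along o s) - f (along o t)| <= C * `|s - t|.
  move=> sL tL; apply: (cvgr_to_le (F := U)).
    by apply: cvg_norm; apply: cvgB; exact: Ff.
  by apply: filterS FC => i Fi; exact: lipschitz_along.
exists f => //; apply: admissible_uniform_closed => eps eps0.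
have near_vertices : \forall i \near U, forall w : vert S,
    `|f (real (inl w)) - F i (real (inl w))| < eps.
  by apply: filter_forall => w; apply: cvgr_dist_lt.
have near_edges : \forall i \near U, forall e : edge S, forall t,
    0 <= t <= len e -> `|f (real (chart e t)) - F i (real (chart e t))| < eps.
  apply: filter_forall => e; pose o : oedge S := (e, false).
  pose P i t := 0 <= t <= len e ->
    `|f (real (chart e t)) - F i (real (chart e t))| < eps.
  suff : \forall i \near U, `[0, len e]%classic `<=` P i.
    by apply: filterS => i iP t tL; apply: iP; rewrite //= in_itv.
  have /compact_near_coveringP := @segment_compact R 0 (len e).
  apply=> t; rewrite /= in_itv /= => tL.
  (* One third of [eps] each for moving [f], moving [F i], and comparing them at [t]. *)
  have d0 : 0 < eps / 3 / C by rewrite !divr_gt0.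
  exists (ball t (eps / 3 / C),
          [set i | compatible S (F i) /\
             `|f (real (chart e t)) - F i (real (chart e t))| < eps / 3]).
    split; first exact: nbhsx_ballx.
    apply: filterI => //; apply: cvgr_dist_lt; last by rewrite divr_gt0.
    exact: Ff.
  move=> [s i] [/= ts [Fi fFi]] sL.
  have {}ts : C * `|t - s| < eps / 3 by rewrite -ltr_pdivlMl // mulrC.
  have := f_lip o t s tL sL.
  have := lipschitz_along (o := o) Fi tL sL.
  rewrite /along /= -/C; move: fFi.
  by rewrite !(ltr_norml, ler_norml); lra.
have [i [[Mi _] [iV iE]]] :=
  filter_ex (filterI FM (filterI near_vertices near_edges)).
exists (F i) => // x; have [rinv _ rinvK] := real_bij S.
rewrite -(rinvK x); case: (point_chart (rinv x)) => [[w ->]|[e [t [tL ->]]]].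
  exact: iV.
exact: iE.
Qed.

End Limits.

Lemma slope_vector_inj (R : realType) (X : metricType R) (r : nat)
  (S : slope_structure X r) (x : X) : injective (@slope_vector R X r S x).
Proof.
move=> a b /ffunP ab; apply/ffunP => o; have := ab o; rewrite !ffunE => oab.
case: (ltngtP (a o) (b o)) => [|/(oslope_incr (val o))|/ord_inj //].
  by move=> /(oslope_incr (val o)); rewrite oab ltxx.
by rewrite oab ltxx.
Qed.

Lemma drops_addr (R : realType) (X : metricType R) (r : nat)
  (S : slope_structure X r) (f : X -> R) (c : R) (x : X) :
  drops S f x -> drops S (fun y => f y + c) x.
Proof.
move=> fx o t h h' xE h'0 h't h0 thL.
have cancel_c y z : y + c - (z + c) = y - z by ring.
by rewrite !cancel_c; exact: fx.
Qed.

(** For fixed parameters, the condition is a closed inequality in three values of the function. *)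
Lemma drops_cvg (R : realType) (X : metricType R) (r : nat)
    (S : slope_structure X r) (T : Type) (U : set_system T)
    (U_proper : ProperFilter U) (F : T -> X -> R) (f : X -> R) (x : X) :
  (forall y, F i y @[i --> U] --> f y) ->
  (\forall i \near U, drops S (F i) x) -> drops S f x.
Proof.
move=> Ff Fx o t h h' xE h'0 h't h0 thL.
apply: (cvgr_to_le (F := U)).
  by apply: cvgD; (apply: cvgM; last exact: cvg_cst); apply: cvgB; exact: Ff.
by apply: filterS Fx => i; exact.
Qed.

(** * The effective divisors used as tests *)

Section PointDivisor.
Context (X : choiceType) (k : int) (v : X) (P : seq X).
Context (vP_uniq : uniq (v :: P)).

Definition point_coef (x : X) : int := (if x == v then k else 0) + (x \in P)%:Z.

Lemma point_coef_supp x : x \notin v :: P -> point_coef x = 0.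
Proof.
by rewrite inE negb_or /point_coef => /andP[/negbTE -> /negbTE ->].
Qed.

Lemma point_coef_finite : finite_set [set x | point_coef x != 0].
Proof.
apply: (@sub_finite_set _ _ [set` v :: P]) => [x /=|]; last exact: finite_seq.
by apply: contra_neqT => /point_coef_supp.
Qed.

Definition point_divisor := Divisor point_coef_finite.

Lemma degree_point_divisor : degree point_divisor = k + (size P)%:Z.
Proof.
rewrite /degree -(@fsbig_widen _ _ _ _ [set` v :: P] setT)//; last first.
  by move=> x [_ /= /negP]; exact: point_coef_supp.
rewrite -fsbig_seq// big_cons /= /point_coef eqxx.
have /andP[/negbTE -> P_uniq] := vP_uniq; rewrite addr0; congr (_ + _).
rewrite -sum1_size -natz natr_sum; apply: eq_big_seq => x xP.
rewrite xP; case: eqP => // xv; move: vP_uniq; rewrite -xv /= xP //.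
Qed.

End PointDivisor.

(** * Forcing slope indices at a point by drops *)

Section Forcing.
Context (R : realType) (X : metricType R) (r : nat) (S : slope_structure X r).
Context (D : divisor X) (M : set (X -> R)) (M_adm : admissible D S M).
Context (v : X).

(** Phrased with [drops] rather than ranks at [P], so that its hypotheses survive limits. *)
Definition forces (P : seq X) (c : cube r (tangent S v)) : Prop :=
  forall f (b : cube r (tangent S v)), M f ->
    (forall x, x \in P -> drops S f x) ->
    partial S f v = slope_vector b -> cube_le c b.

(** By injectivity of [along], each point of [P] is met at most once. *)
Lemma near_along_notin (o : oedge S) t (P : seq X) : 0 <= t < len o.1 ->
  \forall h \near 0^'+, along o (t + h) \notin P.
Proof.
move=> tL; elim: P => [|p P IH]; first by apply: nearW.
near=> h; rewrite inE negb_or; apply/andP; split; last by near: h.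
near: h; apply/near_right0P.
have [[u uL up]|no_p] := pselect
    (exists2 u, 0 < u < len o.1 - t & along o (t + u) = p).
  exists u; first by case/andP: uL.
  move=> h hu; apply/eqP; rewrite -up => /(along_inj (smodel_simple S)).
  by rewrite !inE => hE; have : t + h = t + u; [apply: hE|]; lra.
exists (len o.1 - t) => [|h hL]; first by lra.
by apply/eqP => hp; apply: no_p; exists h.
Unshelve. all: by end_near. Qed.

(* A function dropping at [t + e] has slope at most [s - 1] past that point;
   as [e] tends to 0 this becomes a bound on the slope at [t] itself. *)
Lemma drops_secant_le (F : X -> R) (o : oedge S) (t h e s : R) :
  0 <= t -> 0 < e < h -> t + h <= len o.1 ->
  F (along o (t + e)) - F (along o t) <= s * e ->
  drops S F (along o (t + e)) ->
  F (along o (t + h)) - F (along o t) <= (s - 1) * h + e.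
Proof.
move=> t0 eh thL Fe /(_ o (t + e) (h - e) e erefl).
(* The drop at [t + e] is tested against the points [t + h] and [t]. *)
have -> : t + e + (h - e) = t + h by ring.
have -> : t + e - e = t by ring.
move: Fe; set a := F (along o (t + h)); set b := F (along o (t + e)).
set c := F (along o t) => Fe H.
have {}H : (a - b) * e + (c - b) * (h - e) <= - ((h - e) * e) by apply: H; lra.
have : (b - c) * h <= s * e * h by apply: ler_wpM2r => //; lra.
move=> bc; rewrite -(ler_pM2r (_ : 0 < e)); last by lra.
lra.
Qed.

Lemma forces_succ (P : seq X) (c' c : cube r (tangent S v)) (i : tangent S v) :
  uniq (v :: P) -> forces P c' ->
  (forall j, (c j : nat) = (c' j + (j == i))%N) ->
  exists x, uniq (v :: x :: P) /\ forces (x :: P) c.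
Proof.
move=> vP Pc' cE; apply: contrapT => no_x.
have /asboolP[t tL tv] :
    `[< exists2 t, 0 <= t < len (val i).1 & along (val i) t = v >].
  by have := valP i; rewrite /tangent_set inE.
pose o := val i; pose s : R := (oslope o (c' i))%:~R.
pose good (e : R) (F : X -> R) := [/\ M F, F v = 0,
  forall x, x \in P -> drops S F x, drops S F (along o (t + e)) &
  forall h, 0 <= h -> t + h <= len o.1 -> F (along o (t + h)) <= s * h].
have near_good : \forall e \near 0^'+, exists F, good e F.
  near=> e.
  have vxP : uniq (v :: along o (t + e) :: P).
    have : along o (t + e) \notin v :: P by near: e; exact: near_along_notin.
    by move: vP; rewrite /= !inE !negb_or eq_sym => /andP[-> ->] /andP[-> ->].
  have /existsNP[f /existsNP[b /not_implyP[Mf /not_implyP[f_drops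
      /not_implyP[fb cb]]]]] : ~ forces (along o (t + e) :: P) c.
    by move=> x_forces; apply: no_x; exists (along o (t + e)).
  have c'b : cube_le c' b.
    by apply: Pc' fb => // x xP; apply: f_drops; rewrite inE xP orbT.
  (* [b] is above [c'] but not above [c], and these differ only at [i]. *)
  have bi : b i = c' i.
    apply/ord_inj/eqP; rewrite eqn_leq c'b andbT leqNgt; apply/negP => c'bi.
    by apply: cb => j; rewrite cE; have := c'b j; case: eqP => [->|_]; lia.
  exists (fun x => f x + - f v); split.
  - by case: M_adm => -[_ _ Mshift] _ _ _; exact: Mshift.
  - by rewrite subrr.
  - by move=> x xP; apply/drops_addr/f_drops; rewrite inE xP orbT.
  - by apply/drops_addr/f_drops; rewrite inE eqxx.
  - move=> h h0 thL; rewrite lerBlDl /s -bi -(slope_partial i fb) -/o.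
    have /andP[t0 _] := tL.
    have := concave_along (o := o) (admissible_compatible M_adm Mf) t0 h0 thL.
    by rewrite tv.
(* The zero function is a dummy for those [e] without a good function. *)
have /choice[F Fgood] e : exists f, (exists g, good e g) -> good e f.
  have [[f fg]|ng] := pselect (exists f, good e f); first by exists f.
  by exists (fun=> 0).
(* [U] makes [e] tend to 0 from the right while all bounded limits exist. *)
have [U [U_ultra sub_U]] := ultraFilterLemma (at_right_proper_filter (0 : R)).
have {near_good}U_good : \forall e \near U, good e (F e).
  by apply: filterS (sub_U _ near_good) => e /Fgood.
have [|f Mf Ff] := admissible_limit M_adm U_ultra (F := F) (v := v).
  by apply: filterS U_good => e [].
have fC := admissible_compatible M_adm Mf.
have [fR fS] := fC; have [_ [b _ fb]] := fS v.
have c'b : cube_le c' b.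
  apply: Pc' fb => // x xP; apply: drops_cvg Ff _.
  by apply: filterS U_good => e [_ _ + _ _]; exact.
(* The limit still drops at [P], so its index at [i] is at least [c' i]. *)
have s_le : s <= (slope f v o)%:~R.
  by rewrite (slope_partial i fb) ler_int; apply: oslope_le_homo; exact: c'b.
have /near_right0P[d d0 fd] := slope_near (smodel_simple S) fR tL.
pose h := Num.min d (len o.1 - t) / 2.
have h0 : 0 < h by rewrite divr_gt0// lt_min d0 /= subr_gt0; case/andP: tL.
have [hd hL] : h < d /\ t + h < len o.1.
  by rewrite /h; case: (leP d (len o.1 - t)); lra.
have := fd h; rewrite h0 hd tv => /(_ isT) fh.
(* With [e < h / 2] the secant bound stays below [s * h], while [f] has slope at least [s] up to
   [h]. *)
suff fle : f (along o (t + h)) - f v <= (s - 1) * h + h / 2.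
  have : s * h <= (slope f v o)%:~R * h by rewrite ler_pM2r.
  by move: fle; rewrite fh; lra.
apply: (cvgr_to_le (F := U)); first by apply: cvgB; exact: Ff.
have : \forall e \near U, 0 < e < h / 2.
  by apply: sub_U; apply/near_right0P; exists (h / 2) => //; exact: divr_gt0.
apply: filterS2 U_good => e [_ Fv _ Fx Fs] eh.
rewrite -tv.
apply: le_trans (drops_secant_le (e := e) (s := s) _ _ _ _ _) _ => //.
- by lra.
- by lra.
- by lra.
- by rewrite tv Fv subr0; apply: Fs; lra.
- by lra.
Unshelve. all: by end_near. Qed.

(** Induction on the coordinate sum. A unit step from [c'] to [c] either keeps the rank, and [P] is
    kept, or lowers it by exactly 1, and [P] gains one point. At the origin [P] is empty. *)
Lemma forces_exists (c : cube r (tangent S v)) :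
  tangent S v -> 0 <= rho S v c ->
  exists P : seq X,
    [/\ uniq (v :: P), (size P)%:Z = r%:Z - rho S v c & forces P c].
Proof.
move=> i0; have [n] := ubnP (\sum_i c i)%N; elim: n c => // n IH c cn c_ge0.
have rhoP := rho_rank_function S v.
have [[i ci]|c0] := pselect (exists i, (0 < c i)%N); last first.
  exists [::]; split=> // [|f b _ _ _ i]; last first.
    by case: posnP (fun ci => c0 (ex_intro _ i ci)) => [->//|? /(_ isT)].
  suff -> : c = [ffun=> ord0] by rewrite rank_cube0// subrr.
  apply/ffunP => i; apply/ord_inj; rewrite ffunE /=.
  by case: posnP (fun ci => c0 (ex_intro _ i ci)) => // ? /(_ isT).
have [c' c'E] := cube_pred_exists ci.
have c'_le : rho S v c <= rho S v c'.
  by case: rhoP => _ + _ _; apply => j; rewrite c'E leq_addr.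
have rho_c' := rank_succ_ge rhoP c'E.
have [||P [vP sP Pc']] := IH c'.
- move: cn; rewrite ltnS; apply: leq_trans.
  rewrite (eq_bigr _ (fun j _ => c'E j)) big_split /=.
  by rewrite -addn1 leq_add2l (bigD1 i)//= eqxx.
- exact: le_trans c'_le.
have [rhoE|rho_neq] := eqVneq (rho S v c) (rho S v c').
  exists P; split=> //; first by rewrite sP rhoE.
  move=> f b Mf f_drops fb.
  have [_ /(_ v)[_ [b' b'_jump fb']]] := admissible_compatible M_adm Mf.
  (* The index vector of [f] at [v] is a jump, as the rank-preserving case requires. *)
  have bb' : b = b' by apply: slope_vector_inj; rewrite -fb -fb'.
  by apply: (jump_gt_of_rank_eq rhoP _ c'E rhoE); [rewrite bb'|exact: Pc' fb].
have [x [vxP xPc]] := forces_succ vP Pc' c'E.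
by exists (x :: P); split=> //=; lia.
Qed.

End Forcing.

Theorem theorem1p2 (R : realType) (Gamma : metric_graph R) (r : nat)
    (D : divisor Gamma) (S : slope_structure Gamma r) (M : set (Gamma -> R))
    (M_adm : admissible D S M) (v : Gamma) (a : cube r (tangent S v))
    (a_jump : is_jump (rho S v) a) :
  exists2 f : Gamma -> R, M f & partial S f v = slope_vector a.
Proof.
have M_exists k (P : seq Gamma) : uniq (v :: P) -> 0 <= k ->
    k + (size P)%:Z = r%:Z -> exists2 f, M f &
      forall x, exists2 b : cube r (tangent S x),
        partial S f x = slope_vector b &
        (if x == v then k else 0) + (x \in P)%:Z <= rho S x b.
  move=> vP k0 kP; case: M_adm => _ _ _ /(_ (point_divisor k v P)).
  case=> [x||f Mf [fE _]]; last by exists f.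
    by rewrite /= /point_coef; case: eqP => _; lia.
  by rewrite degree_point_divisor.
(* With no tangent vector both sides are the empty function, so any element of [M] will do. *)
have [[i0 _]|no_tangent] := pselect (exists i : tangent S v, True); last first.
  have [|||f Mf _] := @M_exists r%:Z [::]; rewrite ?addr0//.
  by exists f => //; apply/ffunP => i; case: no_tangent; exists i.
have a_ge0 := a_jump.1.
have [P [vP sP Pa]] := forces_exists M_adm i0 a_ge0.
(* The degree is [rho S v a] plus the size [r - rho S v a] of [P]. *)
have [||f Mf fE] := @M_exists (rho S v a) P vP; rewrite ?sP//; first by ring.
exists f => //; have [b fb] := fE v; rewrite eqxx.
have /andP[/negbTE -> _] := vP; rewrite addr0 => ab.
rewrite fb; congr slope_vector.
apply/esym/(jump_maximal (rho_rank_function S v)) => //.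
apply: (Pa f b) => // x xP; have [bx fbx] := fE x.
(* Away from [v], a point of [P] has coefficient 1, hence rank at least 1 and a drop. *)
have xv : x != v by apply: contraTneq xP => ->; case/andP: vP.
rewrite (negbTE xv) xP add0r => rank1.
exact: drops_of_rank (admissible_compatible M_adm Mf) fbx rank1.
Qed.
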